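(* Let $\gamma>0$, $s_1,s_2>0$, and $L=2+s_1+s_2$. For $\alpha\in[-\frac{\pi}{L},\frac{\pi}{L}]$ let $\mathcal{C}^{\gamma,\alpha}$ be the $2\times 2$ quasiperiodic gauge capacitance matrix of a periodically repeated dimer with resonators of length $1$ and spacings $s_1,s_2$. Then the two eigenvalues of $\mathcal{C}^{\gamma,\alpha}$ coalesce if and only if $\alpha=\pm\frac{\pi}{L}$ and $$\cosh(\gamma)\,(s_1^2-6s_1s_2+s_2^2)+(s_1+s_2)^2=0.$$ The geometric multiplicity of the eigenvalue is then $1$.
   Context: The quasiperiodic gauge capacitance matrix of a periodically repeated dimer ($N=2$, $\ell_1=\ell_2=1$, unit cell length $L=2+s_1+s_2$) is the complex matrix with entries $$\mathcal{C}^{\gamma,\alpha}_{1,1}=\frac{\gamma}{s_1}\frac{1}{1-e^{-\gamma}}-\frac{\gamma}{s_2}\frac{1}{1-e^{\gamma}},\qquad \mathcal{C}^{\gamma,\alpha}_{2,2}=\frac{\gamma}{s_2}\frac{1}{1-e^{-\gamma}}-\frac{\gamma}{s_1}\frac{1}{1-e^{\gamma}},$$ $$\mathcal{C}^{\gamma,\alpha}_{1,2}=-\frac{\gamma}{s_1}\frac{1}{1-e^{-\gamma}}+e^{\mathbf{i}\alpha L}\frac{\gamma}{s_2}\frac{1}{1-e^{\gamma}},\qquad \mathcal{C}^{\gamma,\alpha}_{2,1}=\frac{\gamma}{s_1}\frac{1}{1-e^{\gamma}}-e^{-\mathbf{i}\alpha L}\frac{\gamma}{s_2}\frac{1}{1-e^{-\gamma}}.$$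 The points $\alpha=-\pi/L$ and $\alpha=\pi/L$ give the same matrix. The two eigenvalues ''coalesce'' means they are equal. *)

(* Defs.v *)
From HB Require Import structures.
From mathcomp Require Import all_boot all_order all_algebra.
From mathcomp Require Import complex.
From mathcomp Require Import reals sequences exp trigo.

Set Implicit Arguments.
Unset Strict Implicit.
Unset Printing Implicit Defensive.

Import Order.TTheory GRing.Theory Num.Theory.
Local Open Scope ring_scope.
Local Open Scope complex_scope.

Definition cosh (R : realType) (x : R) : R := (expR x + expR (- x)) / 2.

(* e^(i t) for real t *)
Definition expi (R : realType) (t : R) : R[i] := cos t +i* sin t.

(* Two unit-length resonators and two spacings per period. *)
Definition cell_length (R : realType) (s1 s2 : R) : R := 2 + s1 + s2.

Definition gauge_capacitance (R : realType) (gamma s1 s2 alpha : R) :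
    'M[R[i]]_2 :=
  let L := cell_length s1 s2 in
  \matrix_(i < 2, j < 2)
    match val i, val j with
    | 0%N, 0%N => (gamma / s1 * (1 / (1 - expR (- gamma)))
                   - gamma / s2 * (1 / (1 - expR gamma)))%:C
    | 0%N, _ => - (gamma / s1 * (1 / (1 - expR (- gamma))))%:C
                + expi (alpha * L)
                  * (gamma / s2 * (1 / (1 - expR gamma)))%:C
    | _, 0%N => (gamma / s1 * (1 / (1 - expR gamma)))%:C
                - expi (- (alpha * L))
                  * (gamma / s2 * (1 / (1 - expR (- gamma))))%:C
    | _, _ => (gamma / s2 * (1 / (1 - expR (- gamma)))
               - gamma / s1 * (1 / (1 - expR gamma)))%:C
    end.

(* s lists the eigenvalues of A, repeated with algebraic multiplicity. *)
Definition is_eigenvalue_list (F : fieldType) (n : nat) (A : 'M[F]_n)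
    (s : seq F) : Prop :=
  char_poly A = \prod_(l <- s) ('X - l%:P).

(* Over R[i] such a list always exists, so quantifying over it is not vacuous. *)
Lemma eigenvalue_list_exists (R : realType) (A : 'M[R[i]]_2) :
  exists l1 l2 : R[i], is_eigenvalue_list A [:: l1; l2].
Proof.
have [s] := closed_field_poly_normal (char_poly A).
rewrite (monicP (char_poly_monic A)) scale1r => def_s.
have := size_char_poly A; rewrite def_s size_prod_XsubC => -[].
case: s def_s => [|l1 [|l2 [|l3 s]]] // def_s _.
by exists l1, l2.
Qed.

(* MathComp's [eigenspace] consists of row vectors v with v *m A = a *: v;
   transposing gives the usual column eigenvectors. *)
Definition geometric_multiplicity (F : fieldType) (n : nat) (A : 'M[F]_n)
    (a : F) : nat :=
  \rank (eigenspace A^T a).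

(* Main.v *)
Require Import Defs.
From HB Require Import structures.
From mathcomp Require Import all_boot all_order all_algebra.
From mathcomp Require Import complex.
From mathcomp Require Import reals sequences exp trigo.
From mathcomp Require Import ring lra.

Set Implicit Arguments.
Unset Strict Implicit.
Unset Printing Implicit Defensive.

Import Order.TTheory GRing.Theory Num.Theory.
Local Open Scope ring_scope.
Local Open Scope complex_scope.

(* The eigenvalues coalesce iff the discriminant
   [(C11 - C22)^2 + 4 C12 C21] vanishes. Put [a = gamma / s1],
   [b = gamma / s2], [p = 1 / (1 - e^-gamma)], [q = 1 / (1 - e^gamma)] and
   [t = alpha L]. Since [p + q = 1], the discriminant has imaginary part
   [4ab (q - p) sin t] with [q < 0 < p], so [t] is [0] or [+-pi]. At [t = 0] it
   equals [((a + b) (p - q))^2 > 0]; at [t = +-pi], clearing denominators with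
   [- p q = 1 / (2 (cosh gamma - 1))] gives the stated equation. A scalar matrix
   would need [a = b] and [p = e^(it) q], which [p > |q|] excludes; so the
   coalesced eigenvalue is defective. *)

Lemma det_mx2 (F : comNzRingType) (A : 'M[F]_2) :
  \det A = A 0 0 * A 1 1 - A 0 1 * A 1 0.
Proof.
rewrite (expand_det_row _ 0) !big_ord_recl big_ord0 addr0 /cofactor !det_mx11.
have e1 : lift 0 0 = 1 :> 'I_2 by apply: val_inj.
have e0 : lift 1 0 = 0 :> 'I_2 by apply: val_inj.
by rewrite !mxE !e1 e0 expr0 expr1 !mul1r mulN1r mulrN.
Qed.

(** Comparing coefficients of the characteristic polynomial gives the trace and the determinant, and
    [(l1 - l2)^2 = (l1 + l2)^2 - 4 l1 l2]. Squaring avoids choosing a root of the discriminant. *)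
Lemma sqr_sub_eigenvalues2 (F : fieldType) (A : 'M[F]_2) (l1 l2 : F) :
  is_eigenvalue_list A [:: l1; l2] ->
  (l1 - l2) ^+ 2 = (A 0 0 - A 1 1) ^+ 2 + 4 * (A 0 1 * A 1 0).
Proof.
rewrite /is_eigenvalue_list !big_cons big_nil mulr1 => charA.
have trA : l1 + l2 = A 0 0 + A 1 1.
  have e1 : lift 0 0 = 1 :> 'I_2 by apply: val_inj.
  have := @char_poly_trace _ 2 A isT.
  rewrite charA /mxtrace coefM !big_ord_recl !big_ord0 !coefB !coefX !coefC /=.
  (* The unfolded trace ends in [+ 0], which is restored on the right so that [H] matches. *)
  by rewrite e1 => H; apply: oppr_inj; rewrite -[in RHS](addr0 (A 1 1)) -H; ring.
have detA : l1 * l2 = A 0 0 * A 1 1 - A 0 1 * A 1 0.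
  have := char_poly_det A.
  rewrite charA det_mx2 coefM !big_ord_recl !big_ord0 !coefB !coefX !coefC /=.
  by rewrite sqrrN expr1n mul1r => <-; ring.
have -> : (l1 - l2) ^+ 2 = (l1 + l2) ^+ 2 - 4 * (l1 * l2) by ring.
by rewrite trA detA; ring.
Qed.

(** [A - l%:M] is nonzero because [A] is not scalar, and singular because [l] is an eigenvalue; so
    its rank is 1, and so is its nullity. *)
Lemma geometric_multiplicity2_eq1 (F : fieldType) (A : 'M[F]_2) (l : F) :
  is_eigenvalue_list A [:: l; l] -> ~~ is_scalar_mx A ->
  geometric_multiplicity A l = 1%N.
Proof.
move=> charA nsA.
have rank_gt0 : (0 < \rank (A - l%:M)%R)%N.
  rewrite lt0n mxrank_eq0 subr_eq0; apply: contraNneq nsA => ->.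
  exact: scalar_mx_is_scalar.
have rank_lt2 : (\rank (A - l%:M)%R < 2)%N.
  have : eigenvalue A l.
    by rewrite eigenvalue_root_char charA big_cons rootM root_XsubC eqxx.
  by rewrite /eigenvalue /eigenspace -mxrank_eq0 mxrank_ker -lt0n subn_gt0.
rewrite /geometric_multiplicity /eigenspace mxrank_ker -mxrank_tr.
rewrite linearB /= trmxK tr_scalar_mx.
by case: (\rank _) rank_gt0 rank_lt2 => [|[|]].
Qed.

Lemma scaled_cell_bounds (R : realType) (L alpha : R) :
  0 < L -> - (pi / L) <= alpha <= pi / L -> - pi <= alpha * L <= pi.
Proof. by move=> L_gt0; rewrite -ler_pdivlMr // -mulNr ler_pdivrMr. Qed.

Lemma sin_eq0_cases (R : realType) (t : R) :
  - pi <= t <= pi -> sin t = 0 -> [\/ t = 0, t = - pi | t = pi].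
Proof.
move=> /andP[t_ge t_le] sint0.
have [t_lt0|t_gt0|->] := ltgtP t 0; last by constructor 1.
- have [t_gt||<-] := ltgtP (- pi) t; [|by rewrite ltNge t_ge|by constructor 2].
  have : 0 < sin (- t) by apply: sin_gt0_pi; rewrite oppr_gt0 t_lt0 ltrNl.
  by rewrite sinN sint0 oppr0 ltxx.
- have [t_lt||->] := ltgtP t pi; [|by rewrite ltNge t_le|by constructor 3].
  have : 0 < sin t by apply: sin_gt0_pi; rewrite t_gt0.
  by rewrite sint0 ltxx.
Qed.

(** The diagonal entries differ by [(a - b)(p + q)]. In the product of the off-diagonal ones the
    phases cancel except in [a b (q^2 e^(it) + p^2 e^(-it))], whose two weights differ; hence the
    imaginary part. *)
Lemma gauge_capacitance_discriminant (R : realType) (gamma s1 s2 alpha : R) :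
  let A := gauge_capacitance gamma s1 s2 alpha in
  let t := alpha * cell_length s1 s2 in
  let a := gamma / s1 in let b := gamma / s2 in
  let p := 1 / (1 - expR (- gamma)) in let q := 1 / (1 - expR gamma) in
  (A 0 0 - A 1 1) ^+ 2 + 4 * (A 0 1 * A 1 0) =
  (((a - b) * (p + q)) ^+ 2 - 4 * p * q * (a ^+ 2 + b ^+ 2)
   + 4 * a * b * (p ^+ 2 + q ^+ 2) * cos t)
  +i* (4 * a * b * (q ^+ 2 - p ^+ 2) * sin t).
Proof.
move=> A t a b p q.
have cs : cos t * cos t = 1 - sin t * sin t.
  by rewrite -!expr2 -(cos2Dsin2 t); ring.
rewrite !mxE /= /expi -/t -/a -/b -/p -/q cosN sinN.
rewrite (_ : 4 = 4%:C); last by rewrite rmorph_nat.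
apply/eqP; rewrite eq_complex /=; apply/andP.
by split; apply/eqP; ring: cs.
Qed.

(** With [x = e^gamma > 1]: [p = x / (x - 1)], [q = - 1 / (x - 1)] and
    [cosh gamma - 1 = (x - 1)^2 / (2 x)]. *)
Lemma gauge_weights (R : realType) (gamma : R) : 0 < gamma ->
  let p := 1 / (1 - expR (- gamma)) in let q := 1 / (1 - expR gamma) in
  [/\ p + q = 1, q < 0 & 2 * (p * q) * (cosh gamma - 1) = - 1].
Proof.
move=> gamma_gt0 p q; rewrite /p /q /cosh expRN.
have := expR_gt1 gamma; rewrite gamma_gt0; set x := expR gamma => x_gt1.
have x_neq0 : x != 0 by rewrite gt_eqF // (lt_trans ltr01).
have x1_neq0 : 1 - x != 0 by rewrite subr_eq0 lt_eqF.
have x1_neq0' : x - 1 != 0 by rewrite subr_eq0 gt_eqF.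
split; first by field; rewrite x_neq0 x1_neq0' x1_neq0.
  by rewrite div1r invr_lt0 subr_lt0.
by field; rewrite x_neq0 x1_neq0' x1_neq0.
Qed.

Lemma gauge_capacitance_coalesce (R : realType) (gamma s1 s2 alpha : R) :
  0 < gamma -> 0 < s1 -> 0 < s2 ->
  let A := gauge_capacitance gamma s1 s2 alpha in
  let t := alpha * cell_length s1 s2 in
  - pi <= t <= pi ->
  (A 0 0 - A 1 1) ^+ 2 + 4 * (A 0 1 * A 1 0) = 0 <->
  (t = - pi \/ t = pi) /\
  cosh gamma * (s1 ^+ 2 - 6 * s1 * s2 + s2 ^+ 2) + (s1 + s2) ^+ 2 = 0.
Proof.
move=> gamma_gt0 s1_gt0 s2_gt0 A t t_bounds.
rewrite gauge_capacitance_discriminant -/t.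
have [] := gauge_weights gamma_gt0.
set p := 1 / (1 - expR (- gamma)); set q := 1 / (1 - expR gamma) => pq1 q_lt0.
move=> pqc.
set a := gamma / s1; set b := gamma / s2.
have a_gt0 : 0 < a by apply: divr_gt0.
have b_gt0 : 0 < b by apply: divr_gt0.
have p_def : p = 1 - q by rewrite -pq1 addrK.
have pq_neq0 : p * q != 0.
  by rewrite mulf_neq0 ?(lt_eqF q_lt0) // p_def gt_eqF; lra.
have [s1_neq0 s2_neq0] : s1 != 0 /\ s2 != 0 by split; rewrite gt_eqF.
have disc_pi : ((a - b) * (p + q)) ^+ 2 - 4 * p * q * (a ^+ 2 + b ^+ 2)
     + 4 * a * b * (p ^+ 2 + q ^+ 2) * - 1 =
   (- 2 * (p * q)) * (gamma / (s1 * s2)) ^+ 2 *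
   (cosh gamma * (s1 ^+ 2 - 6 * s1 * s2 + s2 ^+ 2) + (s1 + s2) ^+ 2).
  (* Write [cosh gamma] as [(cosh gamma - 1) + 1], so that [pqc] eliminates it; the rest is [(s1^2 -
     6 s1 s2 + s2^2) + (s1 + s2)^2 = 2 (s1 - s2)^2]. *)
  rewrite [RHS](_ : _ = - (2 * (p * q) * (cosh gamma - 1)) *
      (gamma / (s1 * s2)) ^+ 2 * (s1 ^+ 2 - 6 * s1 * s2 + s2 ^+ 2)
      - 2 * (p * q) * (gamma / (s1 * s2)) ^+ 2 * (2 * (s1 - s2) ^+ 2));
    last by ring.
  by rewrite pqc p_def /a /b; field; rewrite s1_neq0 s2_neq0.
have factor_neq0 : (- 2 * (p * q)) * (gamma / (s1 * s2)) ^+ 2 != 0.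
  apply: mulf_neq0; first by rewrite mulf_neq0 // oppr_eq0 pnatr_eq0.
  by rewrite expf_neq0 // gt_eqF // divr_gt0 // mulr_gt0.
split=> [[re0 im0] | [t_pi s_eq]].
  have sint0 : sin t = 0.
    apply/eqP; move/eqP: im0; rewrite mulf_eq0 => /orP[|//].
    (* Since [p + q = 1], [q^2 - p^2 = q - p = 2 q - 1 < 0]. *)
    rewrite lt_eqF // pmulr_rlt0; first by rewrite p_def; nra.
    by apply: mulr_gt0 => //; apply: mulr_gt0 => //; rewrite ltr0n.
  have [t0|t_pi|t_pi] := sin_eq0_cases t_bounds sint0.
  - move: re0; rewrite t0 cos0 => re0.
    have : 0 < ((a + b) * (p - q)) ^+ 2.
      apply/exprn_gt0/mulr_gt0; first exact: addr_gt0.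
      by rewrite p_def; lra.
    rewrite (_ : _ ^+ 2 = 0) ?ltxx // -[RHS]re0 p_def.
    by ring.
  - split; first by left.
    move/eqP: re0; rewrite t_pi cosN cospi disc_pi mulf_eq0 (negPf factor_neq0).
    by move/eqP.
  - split; first by right.
    move/eqP: re0; rewrite t_pi cospi disc_pi mulf_eq0 (negPf factor_neq0).
    by move/eqP.
have [cost sint] : cos t = - 1 /\ sin t = 0.
  by case: t_pi => ->; rewrite ?cosN ?sinN cospi sinpi ?oppr0.
by rewrite cost sint disc_pi s_eq !mulr0.
Qed.

Lemma gauge_capacitance_nonscalar (R : realType) (gamma s1 s2 alpha : R) :
  0 < gamma -> 0 < s1 -> 0 < s2 ->
  ~~ is_scalar_mx (gauge_capacitance gamma s1 s2 alpha).
Proof.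
move=> gamma_gt0 s1_gt0 s2_gt0; apply/negP => /is_scalar_mxP[c defA].
have [] := gauge_weights gamma_gt0.
set p := 1 / (1 - expR (- gamma)); set q := 1 / (1 - expR gamma) => pq1 q_lt0 _.
have p_def : p = 1 - q by rewrite -pq1 addrK.
set a := gamma / s1; set b := gamma / s2.
have a_gt0 : 0 < a by apply: divr_gt0.
have b_gt0 : 0 < b by apply: divr_gt0.
have /(congr1 (@complex.Re R)) /= ab : gauge_capacitance gamma s1 s2 alpha 0 0 =
    gauge_capacitance gamma s1 s2 alpha 1 1 by rewrite defA !mxE.
have A01 : gauge_capacitance gamma s1 s2 alpha 0 1 = 0 by rewrite defA !mxE.
move: ab A01; rewrite !mxE /= -/p -/q -/a -/b /expi => ab.
set t := alpha * _ => /eqP; rewrite eq_complex /= => /andP[/eqP re0 _].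
(* Equal diagonal entries mean [(a - b)(p + q) = 0], and [p + q = 1]. *)
have {}ab : b = a by move: ab; rewrite p_def; lra.
move: re0; rewrite ab p_def => re0.
have cost := cos_geN1 t.
(* Now [re0] reads [a q (cos t + 1) = a], whose right side is positive while the left is not. *)
have : 0 <= - (a * q) * (cos t + 1) by apply: mulr_ge0; nra.
nra.
Qed.

Theorem lemma4p5 (R : realType) (gamma s1 s2 alpha : R)
  (hgamma : 0 < gamma) (hs1 : 0 < s1) (hs2 : 0 < s2)
  (halpha : - (pi / cell_length s1 s2) <= alpha <= pi / cell_length s1 s2)
  (l1 l2 : R[i])
  (hl : is_eigenvalue_list (gauge_capacitance gamma s1 s2 alpha) [:: l1; l2]) :
  (l1 = l2 <->
     (alpha = - (pi / cell_length s1 s2) \/ alpha = pi / cell_length s1 s2) /\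
     cosh gamma * (s1 ^+ 2 - 6 * s1 * s2 + s2 ^+ 2) + (s1 + s2) ^+ 2 = 0) /\
  (l1 = l2 ->
     geometric_multiplicity (gauge_capacitance gamma s1 s2 alpha) l1 = 1%N).
Proof.
have L_gt0 : 0 < cell_length s1 s2 by rewrite /cell_length; lra.
have eqP_l : l1 = l2 <-> (l1 - l2) ^+ 2 = 0.
  split=> [-> | /eqP]; first by rewrite subrr expr0n.
  by rewrite sqrf_eq0 subr_eq0 => /eqP.
have tE (u : R) :
    alpha * cell_length s1 s2 = u <-> alpha = u / cell_length s1 s2.
  by split=> [<- | ->]; rewrite ?mulfK ?mulfVK // gt_eqF.
split.
  rewrite eqP_l (sqr_sub_eigenvalues2 hl).
  rewrite gauge_capacitance_coalesce // ?scaled_cell_bounds //.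
  by rewrite !tE mulNr.
move=> l12; rewrite -l12 in hl; apply: geometric_multiplicity2_eq1 hl _.
exact: gauge_capacitance_nonscalar.
Qed.
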